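(* For any integer $n>0$ and any positive real numbers $s$ and $\tau$, $$ns^{n+2}-(n+2)\tau^2s^n+2\tau^{n+2}=\sum_{k=1}^{n}2k\,s^{k-1}\tau^{n-k+1}(\tau-s)^2+n(\tau-s)^2s^n.$$ *)

(* Defs.v *)
From mathcomp Require Export all_boot all_order all_algebra.
From mathcomp Require Export reals.

Set Implicit Arguments.
Unset Strict Implicit.
Unset Printing Implicit Defensive.

(* Main.v *)
Require Import Defs.
From mathcomp Require Import all_boot all_order all_algebra.
From mathcomp Require Import reals.
From mathcomp Require Import ring.

Import Order.TTheory GRing.Theory Num.Theory.
Local Open Scope ring_scope.

(** The sum on the right is a homogenized derivative of a geometric sum: with
    [tau = 1] it is [2 (1 - s)^2] times the derivative of [1 + s + ... + s^n].
    The factor [(tau - s)^2] makes it collapse to three monomials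
    ([arith_geom_sum]), and the theorem is then a polynomial identity in [s],
    [tau], [s^n], [tau^n] and [n]. *)

(** Passing from [n] to [n + 1] multiplies every old summand by [t] and adds one
    new summand, so the closed form follows by induction. *)
Lemma arith_geom_sum (R : comNzRingType) (n : nat) (s t : R) :
  \sum_(1 <= k < n.+1)
     k%:R * s ^+ (k - 1) * t ^+ (n - k + 1) * (t - s) ^+ 2 =
  t ^+ (n + 2) - (n + 1)%:R * s ^+ n * t ^+ 2 + n%:R * s ^+ (n + 1) * t.
Proof.
elim: n => [|n IHn]; first by rewrite big_nil !add0n; ring.
rewrite big_nat_recr //= subnn subn1 /=.
have -> : \sum_(1 <= k < n.+1)
     k%:R * s ^+ (k - 1) * t ^+ (n.+1 - k + 1) * (t - s) ^+ 2 =
   t * \sum_(1 <= k < n.+1)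
     k%:R * s ^+ (k - 1) * t ^+ (n - k + 1) * (t - s) ^+ 2.
  rewrite big_distrr; apply: eq_big_nat => k /andP[_ le_kn] /=.
  by rewrite subSn // addSn exprS; ring.
by rewrite IHn add0n !(addn1, addn2) !exprS; ring.
Qed.

Theorem lemma2p2 (R : realType) (n : nat) (s tau : R)
    (hn : (0 < n)%N) (hs : 0 < s) (htau : 0 < tau) :
  n%:R * s ^+ (n + 2) - (n + 2)%:R * tau ^+ 2 * s ^+ n + 2 * tau ^+ (n + 2) =
  \sum_(1 <= k < n.+1)
     (2 * k%:R * s ^+ (k - 1) * tau ^+ (n - k + 1) * (tau - s) ^+ 2)
  + n%:R * (tau - s) ^+ 2 * s ^+ n.
Proof.
rewrite (eq_bigr (fun k => 2 * (k%:R * s ^+ (k - 1) * tau ^+ (n - k + 1)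
                                * (tau - s) ^+ 2))); last by move=> k _; ring.
by rewrite -mulr_sumr arith_geom_sum !(addn1, addn2) !exprS; ring.
Qed.
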